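(* Let $n\ge2$, let $\vec w\in\mathbb{R}^2$ be a vector not lying along either coordinate axis, let $T=\begin{pmatrix}\eta&1\\0&\eta\end{pmatrix}$ with non-zero real $-1<\eta<1$, and let $A$ be the attractor of the IFS $\Psi_n=\{F_k\}_{k=0}^{n-1}$, $F_k(\vec x)=T\vec x+(n-2k-1)\vec w$. The set $\operatorname{ext}(A)$ of extreme points of $A$ is given by (is the union of the entries of) the unique vector $(B_0,B_1,B_2,B_3)$ of non-empty compact sets solving the following system: (a) if $\eta<0$: $$B_0=F_0(B_2),\quad B_1=\bigcup_{k=0}^{n-2}F_k(B_2)\cup F_{n-1}(B_3),\quad B_2=F_{n-1}(B_0),\quad B_3=F_0(B_1)\cup\bigcup_{k=1}^{n-1}F_k(B_0);$$ (b) if $\eta>0$: $$B_0=\bigcup_{k=0}^{n-2}F_k(B_2)\cup F_{n-1}(B_0),\quad B_1=F_{n-1}(B_1),\quad B_2=F_0(B_2),\quad B_3=F_0(B_3)\cup\bigcup_{k=1}^{n-1}F_k(B_1).$$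
   Context: The attractor $A$ of $\{F_k\}$ is the unique non-empty compact set with $A=\bigcup_k F_k(A)$. $\operatorname{ext}(A)$ denotes $A\cap\partial\operatorname{conv}(A)$ (all points of $A$ on the boundary of its convex hull, not only vertices). *)

(* Defs.v *)
From mathcomp Require Import all_boot all_order all_algebra.
From mathcomp Require Import all_classical all_reals all_analysis.

Set Implicit Arguments.
Unset Strict Implicit.
Unset Printing Implicit Defensive.

Import Order.TTheory GRing.Theory Num.Theory.
Import numFieldNormedType.Exports.

Local Open Scope classical_set_scope.
Local Open Scope ring_scope.

Definition convex_hull (R : numDomainType) (V : lmodType R) (A : set V) : set V :=
  smallest (fun C : set V => convex_set (C : set (convex_lmodType V))) A.

Definition boundary (T : topologicalType) (A : set T) : set T :=
  closure A `\` A°.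

Definition ext_points (R : realType) (A : set 'cV[R]_2) : set 'cV[R]_2 :=
  A `&` boundary (convex_hull A).

(* The IFS {F_k}, k < n, is given by a sequence of maps of which only the first
   n matter. Attractors being unique for the IFS considered here, uniqueness is
   not made part of the predicate. *)
Definition is_attractor (T : topologicalType) (n : nat) (F : nat -> T -> T)
    (A : set T) : Prop :=
  [/\ A !=set0, compact A & A = \bigcup_(k in `I_n) F k @` A].

Definition Tmx (R : realType) (eta : R) : 'M[R]_2 := eta%:M + delta_mx 0 1.

Definition Psi (R : realType) (n : nat) (eta : R) (w : 'cV[R]_2) (k : nat)
    (x : 'cV[R]_2) : 'cV[R]_2 :=
  Tmx eta *m x + (n%:R - 2 * k%:R - 1) *: w.

Definition system_neg (T : Type) (n : nat) (F : nat -> T -> T)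
    (B0 B1 B2 B3 : set T) : Prop :=
  [/\ B0 = F 0%N @` B2,
      B1 = (\bigcup_(k in [set k | (k <= n - 2)%N]) F k @` B2)
           `|` F n.-1 @` B3,
      B2 = F n.-1 @` B0 &
      B3 = F 0%N @` B1
           `|` \bigcup_(k in [set k | (1 <= k <= n.-1)%N]) F k @` B0].

Definition system_pos (T : Type) (n : nat) (F : nat -> T -> T)
    (B0 B1 B2 B3 : set T) : Prop :=
  [/\ B0 = (\bigcup_(k in [set k | (k <= n - 2)%N]) F k @` B2)
           `|` F n.-1 @` B0,
      B1 = F n.-1 @` B1,
      B2 = F 0%N @` B2 &
      B3 = F 0%N @` B3
           `|` \bigcup_(k in [set k | (1 <= k <= n.-1)%N]) F k @` B1].

Definition compact_solution (T : topologicalType)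
    (system : set T -> set T -> set T -> set T -> Prop)
    (B0 B1 B2 B3 : set T) : Prop :=
  [/\ [/\ B0 !=set0, B1 !=set0, B2 !=set0 & B3 !=set0],
      [/\ compact B0, compact B1, compact B2 & compact B3] &
      system B0 B1 B2 B3].

Definition unique_compact_solution (T : topologicalType)
    (system : set T -> set T -> set T -> set T -> Prop)
    (B0 B1 B2 B3 : set T) : Prop :=
  compact_solution system B0 B1 B2 B3 /\
  forall C0 C1 C2 C3 : set T, compact_solution system C0 C1 C2 C3 ->
    [/\ C0 = B0, C1 = B1, C2 = B2 & C3 = B3].

(* Main.v *)
(* A point of the attractor [A] lies on the boundary of the convex hull iff it
   maximises some nonzero linear form over [A]. Write the form as [supp a b],
   where [a] is its value at [w]: precomposition with [T] turns [(a, b)] into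
   [(eta (a + b), eta b)], so the face of [A] exposed by [supp a b] is the image
   of the face for [(eta (a + b), eta b)] under [F_0] if [0 < a], under
   [F_(n-1)] if [a < 0], and under all the [F_k] if [a = 0]. Up to the sign of [eta], the
   dynamics shifts [a] by [b], so the sign of [a] changes at most once along an
   orbit: faces with [a] and [b] on the same side reduce to one of two points
   [vertex true], [vertex false], and the unions [arc true], [arc false] of the
   faces with [0 <= b], resp. [b <= 0], satisfy the other two equations. The
   solution is [(arc true, vertex false, vertex true, arc false)] for [0 < eta]
   and [(vertex true, arc true, vertex false, arc false)] for [eta < 0]; it is
   unique because the [F_k] contract a common norm. *)
Require Import Defs.
From mathcomp Require Import all_boot all_order all_algebra.
From mathcomp Require Import all_classical all_reals all_analysis.
From mathcomp Require Import zify ring lra.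

Import Order.TTheory GRing.Theory Num.Theory.
Import numFieldNormedType.Exports.

Local Open Scope classical_set_scope.
Local Open Scope ring_scope.

Set Implicit Arguments.
Unset Strict Implicit.
Unset Printing Implicit Defensive.

(** * Coordinates and linear forms in the plane *)

Lemma ord2P (P : 'I_2 -> Prop) : P 0 -> P 1 -> forall i, P i.
Proof.
move=> P0 P1 i; case: (unliftP 0 i) => [j ->|->//].
by rewrite ord1 (_ : lift 0 0 = 1)//; exact/val_inj.
Qed.

Lemma colvec2P (R : Type) (x y : 'cV[R]_2) :
  x 0 0 = y 0 0 -> x 1 0 = y 1 0 -> x = y.
Proof. by move=> h0 h1; apply/colP; apply: ord2P. Qed.

Lemma mulmx2E (R : pzRingType) (M : 'M[R]_2) (x : 'cV[R]_2) i :
  (M *m x) i 0 = M i 0 * x 0 0 + M i 1 * x 1 0.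
Proof.
rewrite mxE !big_ord_recl big_ord0 addr0.
by rewrite (_ : lift ord0 ord0 = 1)//; exact/val_inj.
Qed.

Section linear_forms.
Context {R : realType}.
Implicit Types (x y d : 'cV[R]_2) (K : set 'cV[R]_2).

Lemma nbhs_colvec2P x K :
  nbhs x K <-> exists2 e, 0 < e &
    forall y, `|y 0 0 - x 0 0| < e -> `|y 1 0 - x 1 0| < e -> K y.
Proof.
split=> [/nbhs_ballP[e /= e0 xK]|[e e0 xK]]; [|apply/nbhs_ballP];
  exists e => //.
  move=> y y0 y1; apply: xK; split=> // i j; rewrite ord1 /ball /= distrC.
  by move: i; apply: ord2P.
by move=> y [_ xy]; apply: xK; rewrite distrC; exact: xy.
Qed.

Definition lf (u v : R) x : R := u * x 0 0 + v * x 1 0.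

Lemma lfD u v x y : lf u v (x + y) = lf u v x + lf u v y.
Proof. by rewrite /lf !mxE; ring. Qed.

Lemma lfZ u v t x : lf u v (t *: x) = t * lf u v x.
Proof. by rewrite /lf !mxE; ring. Qed.

Lemma convex_comb K x y (t : R) : convex_set (K : set (convex_lmodType _)) ->
  0 <= t <= 1 -> K x -> K y -> K (t *: x + (1 - t) *: y).
Proof.
move=> cK /andP[t0 t1] Kx Ky.
have := cK x y (Itv01 t0 t1); rewrite !inE => /(_ Kx Ky).
by [].
Qed.

Lemma convex_halfplane u v (c : R) :
  convex_set ([set x | lf u v x <= c] : set (convex_lmodType 'cV[R]_2)).
Proof.
move=> x y l; rewrite !inE /= => xc yc.
rewrite /conv /= lfD !lfZ /unstable.onem.
have : 0 <= l%:num by []. have : l%:num <= 1 by [].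
move: (l%:num) => t t1 t0; nra.
Qed.

End linear_forms.

(** * Supporting lines of convex plane sets *)

Section supporting_line.
Context {R : realType}.
Implicit Types (x y d : 'cV[R]_2) (K : set 'cV[R]_2).

Lemma convex_ray K x d (s t : R) : convex_set (K : set (convex_lmodType _)) ->
  K x -> 0 < t -> K (x + t *: d) -> 0 <= s <= t -> K (x + s *: d).
Proof.
move=> cK Kx t0 Kt /andP[s0 st].
have /(@convex_comb _ _ _ _ (s / t) cK) /(_ Kt Kx) : 0 <= s / t <= 1.
  by rewrite divr_ge0 ?(ltW t0)//= ler_pdivrMr// mul1r.
congr K; apply: colvec2P; rewrite !mxE; field; exact: lt0r_neq0.
Qed.

(* If every direction can be followed for a while inside [K], so can the four
   coordinate directions, and the cross they form has [x] in the interior of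
   its hull. *)
Lemma escaping_ray K x : convex_set (K : set (convex_lmodType _)) ->
  K x -> ~ nbhs x K ->
  exists2 d, d != 0 & forall t : R, 0 < t -> ~ K (x + t *: d).
Proof.
move=> cK Kx; apply: contra_notP => noray.
have ray d : d != 0 -> exists2 t : R, 0 < t & K (x + t *: d).
  move=> d0; apply: contrapT => nd; apply: noray; exists d => // t t0 Kt.
  by apply: nd; exists t.
have axis i : exists2 t : R, 0 < t &
    forall s : R, `|s| <= t -> K (x + s *: delta_mx i 0).
  have d0 : delta_mx i 0 != 0 :> 'cV[R]_2.
    apply/eqP => /matrixP /(_ i 0); rewrite !mxE !eqxx => /eqP.
    by rewrite oner_eq0.
  have [t1 t10 K1] := ray _ d0.
  have [|t2 t20 K2] := ray (- delta_mx i 0); first by rewrite oppr_eq0.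
  exists (Num.min t1 t2); first by rewrite lt_min t10.
  move=> s; rewrite le_min => /andP[].
  case: (ger0P s) => s0 s1 s2.
    by apply: (convex_ray cK Kx t10 K1); rewrite s0.
  have := @convex_ray _ _ _ (- s) _ cK Kx t20 K2.
  by rewrite scalerN scaleNr opprK; apply; rewrite s2 andbT; lra.
have [t0 t00 K0] := axis 0; have [t1 t10 K1] := axis 1.
(* A nearby [y] is the midpoint of two points of the cross, displaced from [x] by twice each
   coordinate of [y - x]; hence the halved radius. *)
apply/nbhs_colvec2P; exists (Num.min t0 t1 / 2).
  by rewrite divr_gt0 // lt_min t00.
move=> y y0 y1.
have y0t : `|2 * (y 0 0 - x 0 0)| <= t0.
  by rewrite normrM gtr0_norm//; move: y0; case: (leP t0 t1); lra.
have y1t : `|2 * (y 1 0 - x 1 0)| <= t1.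
  by rewrite normrM gtr0_norm//; move: y1; case: (leP t0 t1); lra.
have half : 0 <= (2^-1 : R) <= 1 by lra.
have := convex_comb cK half (K0 _ y0t) (K1 _ y1t).
by congr K; apply: colvec2P; rewrite !mxE /=; field.
Qed.

(** Take an escaping direction [d] and look for a form [h + th * g], with [h] measured along [d] and
    [g] across it. Since [K] meets the line [g = 0] only where [h <= 0], convexity keeps every lower
    bound imposed on [th] by points with [g < 0] below every upper bound imposed by points with
    [g > 0]. *)
Lemma supporting_line K x : convex_set (K : set (convex_lmodType _)) ->
  K x -> ~ nbhs x K ->
  exists u v, (u != 0) || (v != 0) /\ forall y, K y -> lf u v y <= lf u v x.
Proof.
move=> cK Kx /(escaping_ray cK Kx)[d d0 dK].
set d1 := d 0 0; set d2 := d 1 0.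
have d_neq0 : (d1 != 0) || (d2 != 0).
  rewrite -negb_and; apply: contra d0 => /andP[/eqP e1 /eqP e2].
  by apply/eqP/colvec2P; rewrite mxE.
pose q := d1 ^+ 2 + d2 ^+ 2.
have q0 : 0 < q.
  rewrite lt_def addr_ge0 ?sqr_ge0// andbT paddr_eq0 ?sqr_ge0//.
  by rewrite !sqrf_eq0 negb_and.
pose g y := lf (- d2) d1 y - lf (- d2) d1 x.
pose h y := lf d1 d2 y - lf d1 d2 x.
(* On the line [g = 0] one has [y = x + (h y / q) *: d], so [h y > 0] would put a point of the
   escaping ray in [K]. *)
have gh0 y : K y -> g y = 0 -> h y <= 0.
  move=> Ky gy; rewrite leNgt; apply/negP => hy.
  apply: (dK (h y / q)); first exact: divr_gt0.
  suff <- : y = x + (h y / q) *: d by [].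
  have y0 : q * (y 0 0 - x 0 0) = d1 * h y - d2 * g y.
    by rewrite /g /h /lf /q; ring.
  have y1 : q * (y 1 0 - x 1 0) = d2 * h y + d1 * g y.
    by rewrite /g /h /lf /q; ring.
  have qn0 := lt0r_neq0 q0.
  apply: colvec2P; rewrite !mxE -/d1 -/d2; apply: (mulfI qn0).
    by rewrite -[y 0 0](subrK (x 0 0)) mulrDr y0 gy; field.
  by rewrite -[y 1 0](subrK (x 1 0)) mulrDr y1 gy; field.
(* If [K] lies on one side of the line through [x] directed by [d], that line already supports
   it. *)
have [gge0|] := pselect (forall y, K y -> 0 <= g y).
  exists d2, (- d1); rewrite oppr_eq0 orbC; split=> // y /gge0.
  by rewrite /g /lf; lra.
move=> /existsNP[y1 /not_implyP[Ky1 /negP]]; rewrite -ltNge => gy1.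
have [gle0|] := pselect (forall y, K y -> g y <= 0).
  exists (- d2), d1; rewrite oppr_eq0 orbC; split=> // y /gle0.
  by rewrite /g; lra.
move=> /existsNP[y2 /not_implyP[Ky2 /negP]]; rewrite -ltNge => gy2.
pose S := [set h y / - g y | y in [set y | K y /\ g y < 0]].
have ubS y : K y -> 0 < g y -> ubound S (- h y / g y).
  move=> Ky gy _ [z [Kz gz] <-].
  have gyz : 0 < g y - g z by lra.
  (* The weight at which the segment from [z] to [y] crosses the line [g = 0]. *)
  pose t := - g z / (g y - g z).
  have t01 : 0 <= t <= 1.
    by rewrite divr_ge0 /= ?ler_pdivrMr//; lra.
  have := gh0 _ (convex_comb cK t01 Ky Kz).
  set c := _ + _.
  have -> : g c = 0.
    transitivity (t * g y + (1 - t) * g z).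
      by rewrite /c /g lfD !lfZ; ring.
    by rewrite /t; field; exact: lt0r_neq0.
  have -> : h c = (- g z * h y + g y * h z) / (g y - g z).
    transitivity (t * h y + (1 - t) * h z).
      by rewrite /c /h lfD !lfZ; ring.
    by rewrite /t; field; exact: lt0r_neq0.
  move=> /(_ erefl); rewrite pmulr_lle0 ?invr_gt0// => le0.
  by rewrite ler_pdivrMr ?oppr_gt0// mulrAC ler_pdivlMr//; nra.
have S0 : S !=set0 by exists (h y1 / - g y1), y1.
have supS : has_sup S by split=> //; exists (- h y2 / g y2); exact: ubS.
pose th := sup S.
exists (d1 + th * - d2), (d2 + th * d1); split.
  (* The form is nonzero because its value at [d] is [q], whatever [th] is. *)
  apply: contraT; rewrite negb_or !negbK => /andP[/eqP e1 /eqP e2].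
  suff : q = 0 by lra.
  by transitivity (d1 * (d1 + th * - d2) + d2 * (d2 + th * d1));
    [rewrite /q; ring|rewrite e1 e2 !mulr0 addr0].
move=> y Ky; suff : h y + th * g y <= 0 by rewrite /h /g /lf; lra.
case: (ltgtP (g y) 0) => gy.
- have : h y / - g y <= th by apply: sup_upper_bound => //; exists y.
  by rewrite ler_pdivrMr ?oppr_gt0//; lra.
- have : th <= - h y / g y by apply: ge_sup => //; exact: ubS.
  by rewrite ler_pdivlMr//; lra.
- by rewrite gy mulr0 addr0; exact: gh0.
Qed.

(** A small step from [x] along the gradient [(u, v)] strictly increases the form, yet would stay in
    a neighbourhood of [x]. *)
Lemma lf_max_not_interior (u v : R) K x : (u != 0) || (v != 0) ->
  (forall y, K y -> lf u v y <= lf u v x) -> ~ nbhs x K.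
Proof.
move=> uv0 xmax /nbhs_colvec2P[e e0 eK].
have q0 : 0 < u ^+ 2 + v ^+ 2.
  rewrite lt_def addr_ge0 ?sqr_ge0// andbT paddr_eq0 ?sqr_ge0//.
  by rewrite !sqrf_eq0 negb_and.
pose t := e / (1 + `|u| + `|v|).
have d0 : 0 < 1 + `|u| + `|v| by rewrite !ltr_wpDr.
have t0 : 0 < t by exact: divr_gt0.
pose y : 'cV[R]_2 := x + t *: \col_i (if i == 0 then u else v).
have small c : `|c| < 1 + `|u| + `|v| -> `|t * c| < e.
  by move=> cd; rewrite normrM gtr0_norm// /t mulrAC ltr_pdivrMr// ltr_pM2l.
have u0 := normr_ge0 u; have v0 := normr_ge0 v.
have /xmax : K y.
  by apply: eK; rewrite /y !mxE /= addrAC subrr add0r; apply: small; lra.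
rewrite /y lfD lfZ gerDl pmulr_rle0// /lf !mxE /= -!expr2.
by rewrite leNgt q0.
Qed.

End supporting_line.

(** * Contraction in a weighted norm and uniqueness of compact solutions *)

Definition digit {R : realType} (n k : nat) : R := n%:R - 2 * k%:R - 1.

Section contraction.
Context {R : realType}.
Variables (n : nat) (eta : R) (w : 'cV[R]_2).
Hypothesis heta : -1 < eta < 1.
Implicit Types (x y : 'cV[R]_2) (B C : set 'cV[R]_2).

Let F := Psi n eta w.

Lemma Psi0E k x : F k x 0 0 = eta * x 0 0 + x 1 0 + digit n k * w 0 0.
Proof.
by rewrite /F /Psi /Tmx mxE mulmx2E !mxE /= mulr1n addr0 mulr0n add0r mul1r.
Qed.

Lemma Psi1E k x : F k x 1 0 = eta * x 1 0 + digit n k * w 1 0.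
Proof.
by rewrite /F /Psi /Tmx mxE mulmx2E !mxE /= mulr1n !addr0 mulr0n mul0r add0r.
Qed.

(* [Tmx eta] expands the sup norm by up to [1 + `|eta|]; the weight is chosen so
   that every [F k] contracts this norm by the factor [rate]. *)
Definition wnorm x := `|x 0 0| + 2 / (1 - `|eta|) * `|x 1 0|.

Definition rate := (1 + `|eta|) / 2.

Let eta1 : `|eta| < 1. Proof. by rewrite ltr_norml. Qed.

Let rate_ge0 : 0 <= rate.
Proof. by rewrite divr_ge0// addr_ge0. Qed.

Lemma wnormBE x y :
  wnorm (x - y) = `|x 0 0 - y 0 0| + 2 / (1 - `|eta|) * `|x 1 0 - y 1 0|.
Proof. by rewrite /wnorm !mxE. Qed.

Lemma ler_wnorm0 x : `|x 0 0| <= wnorm x.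
Proof. by rewrite lerDl mulr_ge0// divr_ge0// subr_ge0 ltW. Qed.

Lemma ler_wnorm1 x : `|x 1 0| <= wnorm x.
Proof.
rewrite ler_wpDl// ler_peMl// ler_pdivlMr ?subr_gt0// mul1r.
by have := normr_ge0 eta; lra.
Qed.

Lemma wnorm_eq0 x : wnorm x <= 0 -> x = 0.
Proof.
move=> x0; apply: colvec2P; rewrite mxE; apply/eqP; rewrite -normr_le0.
- by rewrite (le_trans (ler_wnorm0 _)).
- by rewrite (le_trans (ler_wnorm1 _)).
Qed.

Lemma wnorm_Psi k x y : wnorm (F k x - F k y) <= rate * wnorm (x - y).
Proof.
rewrite !wnormBE !Psi0E !Psi1E.
have -> : eta * x 0 0 + x 1 0 + digit n k * w 0 0 -
  (eta * y 0 0 + y 1 0 + digit n k * w 0 0) =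
  eta * (x 0 0 - y 0 0) + (x 1 0 - y 1 0) by ring.
have -> : eta * x 1 0 + digit n k * w 1 0 -
  (eta * y 1 0 + digit n k * w 1 0) = eta * (x 1 0 - y 1 0) by ring.
apply: le_trans (lerD (ler_normD _ _) (lexx _)) _; rewrite !normrM /rate.
move: (`|x 0 0 - _|) (`|x 1 0 - _|) (normr_ge0 (x 0 0 - y 0 0)) => a b a0.
have e1 : 1 - `|eta| != 0 by rewrite subr_eq0 gt_eqF.
(* With [c] the weight of the second coordinate, [rate * c = 1 + |eta| * c]: the weight absorbs the
   off-diagonal entry of [Tmx eta] exactly, so only the coefficients of [a] remain to be
   compared. *)
have -> : (1 + `|eta|) / 2 * (a + 2 / (1 - `|eta|) * b) =
    (1 + `|eta|) / 2 * a + (b + 2 / (1 - `|eta|) * (`|eta| * b)).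
  by field.
by rewrite -addrA lerD2r ler_wpM2r//; move: eta1; lra.
Qed.

Lemma geometric_le0 (z D : R) : (forall m, z <= rate ^+ m * D) -> z <= 0.
Proof.
move=> zD; have r1 : `|rate| < 1 by rewrite ger0_norm// /rate; move: eta1; lra.
have : (fun m => rate ^+ m * D) @ \oo --> (0 * D : R).
  by apply: cvgM; [exact: cvg_expr|exact: cvg_cst].
rewrite mul0r => h; rewrite -(cvg_lim _ h)//; apply: limr_ge.
  by apply/cvg_ex; exists 0.
by near=> m; exact: zD.
Unshelve. all: by end_near. Qed.

(* [Q] is a bisimulation: related points have a common address. *)
Lemma same_address_eq (Q : 'cV[R]_2 -> 'cV[R]_2 -> Prop) (D : R) :
  (forall x y, Q x y -> wnorm (x - y) <= D) ->
  (forall x y, Q x y ->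
    exists k x' y', [/\ x = F k x', y = F k y' & Q x' y']) ->
  forall x y, Q x y -> x = y.
Proof.
move=> QD QF x y Qxy; apply/eqP; rewrite -subr_eq0; apply/eqP/wnorm_eq0.
apply: (@geometric_le0 _ D) => m; elim: m => [|m IHm] in x y Qxy *.
  by rewrite expr0 mul1r QD.
have [k [x' [y' [-> -> /IHm le']]]] := QF _ _ Qxy.
by apply: le_trans (wnorm_Psi _ _ _) _; rewrite exprS -mulrA ler_wpM2l.
Qed.

(** A one-sided Hausdorff bound in [wnorm]; equality of sets comes from using it in both
    directions. *)
Definition close (D : R) C B :=
  forall c, C c -> exists2 b, B b & wnorm (c - b) <= D.

Lemma close_le D D' C B : D <= D' -> close D C B -> close D' C B.
Proof.
by move=> DD' CB c /CB[b Bb cb]; exists b => //; exact: le_trans DD'.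
Qed.

Lemma close_image D C B k :
  close D C B -> close (rate * D) (F k @` C) (F k @` B).
Proof.
move=> CB _ [c /CB[b Bb cb] <-]; exists (F k b); first by exists b.
by apply: le_trans (wnorm_Psi _ _ _) _; rewrite ler_wpM2l.
Qed.

Lemma close_setU D C C' B B' :
  close D C B -> close D C' B' -> close D (C `|` C') (B `|` B').
Proof.
move=> CB CB' c [/CB|/CB'] [b Bb cb]; exists b => //; by [left|right].
Qed.

Lemma close_bigcup D (P : set nat) (C B : nat -> set 'cV[R]_2) :
  (forall k, close D (C k) (B k)) ->
  close D (\bigcup_(k in P) C k) (\bigcup_(k in P) B k).
Proof.
move=> CB c [k Pk /CB[b Bb cb]]; exists b => //; by exists k.
Qed.

Lemma coord_le_norm x i : `|x i 0| <= `|x|.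
Proof.
rewrite [leRHS]/Num.norm /= mx_normrE.
by apply: (le_trans _ (le_bigmax _ _ (i, 0))).
Qed.

Lemma compact_wnorm_bounded C : compact C ->
  exists M, forall x, C x -> wnorm x <= M.
Proof.
move=> /compact_bounded/ex_strict_bound_gt0[M _ /= CM].
exists (M + 2 / (1 - `|eta|) * M) => x /CM/ltW xM.
rewrite lerD ?(le_trans (coord_le_norm _ _))//.
rewrite ler_wpM2l ?(le_trans (coord_le_norm _ _))//.
by rewrite divr_ge0// subr_ge0 ltW.
Qed.

Lemma wnormB x y : wnorm (x - y) <= wnorm x + wnorm y.
Proof.
rewrite wnormBE /wnorm addrACA.
rewrite lerD ?ler_normB// -mulrDr ler_wpM2l ?ler_normB//.
by rewrite divr_ge0// subr_ge0 ltW.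
Qed.

Lemma compact_close C B : compact C -> compact B -> B !=set0 ->
  exists D, close D C B.
Proof.
move=> /compact_wnorm_bounded[M CM] /compact_wnorm_bounded[M' BM'] [b Bb].
exists (M + M') => c Cc; exists b => //.
by rewrite (le_trans (wnormB _ _))// lerD ?CM ?BM'.
Qed.

Lemma close_sub C B : compact B ->
  (forall e, 0 < e -> close e C B) -> C `<=` B.
Proof.
move=> cB CB c Cc; have : closed B by apply: compact_closed.
apply => V /nbhs_colvec2P[e e0 eV].
have /CB /(_ _ Cc)[b Bb cb] : 0 < e / 2 by rewrite divr_gt0.
exists b; split=> //; apply: eV; rewrite distrC.
- have := ler_wnorm0 (c - b); rewrite !mxE; lra.
- have := ler_wnorm1 (c - b); rewrite !mxE; lra.
Qed.

Section compact_solutions.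
Variable system :
  set 'cV[R]_2 -> set 'cV[R]_2 -> set 'cV[R]_2 -> set 'cV[R]_2 -> Prop.

Definition close4 D (C0 C1 C2 C3 B0 B1 B2 B3 : set 'cV[R]_2) :=
  [/\ close D C0 B0, close D C1 B1, close D C2 B2 & close D C3 B3].

Hypothesis contracting : forall D C0 C1 C2 C3 B0 B1 B2 B3,
  system C0 C1 C2 C3 -> system B0 B1 B2 B3 ->
  close4 D C0 C1 C2 C3 B0 B1 B2 B3 -> close4 (rate * D) C0 C1 C2 C3 B0 B1 B2 B3.

(** Bounded solutions are within some finite [D] of each other. Applying the system changes neither
    solution but multiplies the bound by [rate], so it falls below every positive number, and
    closedness gives the inclusions. *)
Lemma compact_solution_sub C0 C1 C2 C3 B0 B1 B2 B3 :
  compact_solution system C0 C1 C2 C3 -> compact_solution system B0 B1 B2 B3 ->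
  [/\ C0 `<=` B0, C1 `<=` B1, C2 `<=` B2 & C3 `<=` B3].
Proof.
move=> [_ [cC0 cC1 cC2 cC3] sC] [[B00 B10 B20 B30] [cB0 cB1 cB2 cB3] sB].
have [D0 h0] := compact_close cC0 cB0 B00.
have [D1 h1] := compact_close cC1 cB1 B10.
have [D2 h2] := compact_close cC2 cB2 B20.
have [D3 h3] := compact_close cC3 cB3 B30.
pose D := `|D0| + `|D1| + `|D2| + `|D3|.
have CBm m : close4 (rate ^+ m * D) C0 C1 C2 C3 B0 B1 B2 B3.
  elim: m => [|m /(contracting sC sB)]; last by rewrite mulrA exprS.
  have := ler_norm D0; have := ler_norm D1.
  have := ler_norm D2; have := ler_norm D3.
  have := normr_ge0 D0; have := normr_ge0 D1.
  have := normr_ge0 D2; have := normr_ge0 D3.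
  move=> ? ? ? ? ? ? ? ?; rewrite mul1r.
  split; [apply: close_le h0|apply: close_le h1|apply: close_le h2|
          apply: close_le h3]; rewrite /D; lra.
have CBe e : 0 < e -> close4 e C0 C1 C2 C3 B0 B1 B2 B3.
  move=> e0; have [m me] : exists m, rate ^+ m * D <= e.
    apply: contrapT => /forallNP h.
    suff : e <= 0 by rewrite leNgt e0.
    apply: (@geometric_le0 _ D) => m.
    by apply: ltW; rewrite ltNge; exact/negP.
  by have [? ? ? ?] := CBm m; split; exact: close_le me _.
by split; apply: close_sub => // e /CBe[].
Qed.

Lemma compact_solution_unique B0 B1 B2 B3 :
  compact_solution system B0 B1 B2 B3 ->
  unique_compact_solution system B0 B1 B2 B3.
Proof.
move=> sB; split=> // C0 C1 C2 C3 sC.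
have [? ? ? ?] := compact_solution_sub sC sB.
have [? ? ? ?] := compact_solution_sub sB sC.
by split; apply/seteqP.
Qed.

End compact_solutions.

Lemma system_neg_contracting D C0 C1 C2 C3 B0 B1 B2 B3 :
  system_neg n F C0 C1 C2 C3 -> system_neg n F B0 B1 B2 B3 ->
  close4 D C0 C1 C2 C3 B0 B1 B2 B3 -> close4 (rate * D) C0 C1 C2 C3 B0 B1 B2 B3.
Proof.
move=> [eC0 eC1 eC2 eC3] [eB0 eB1 eB2 eB3] [h0 h1 h2 h3].
split; [rewrite eC0 eB0|rewrite eC1 eB1|rewrite eC2 eB2|rewrite eC3 eB3].
- exact: close_image.
- by apply: close_setU; [apply: close_bigcup => k|]; exact: close_image.
- exact: close_image.
- by apply: close_setU; [|apply: close_bigcup => k]; exact: close_image.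
Qed.

Lemma system_pos_contracting D C0 C1 C2 C3 B0 B1 B2 B3 :
  system_pos n F C0 C1 C2 C3 -> system_pos n F B0 B1 B2 B3 ->
  close4 D C0 C1 C2 C3 B0 B1 B2 B3 -> close4 (rate * D) C0 C1 C2 C3 B0 B1 B2 B3.
Proof.
move=> [eC0 eC1 eC2 eC3] [eB0 eB1 eB2 eB3] [h0 h1 h2 h3].
split; [rewrite eC0 eB0|rewrite eC1 eB1|rewrite eC2 eB2|rewrite eC3 eB3].
- by apply: close_setU; [apply: close_bigcup => k|]; exact: close_image.
- exact: close_image.
- exact: close_image.
- by apply: close_setU; [|apply: close_bigcup => k]; exact: close_image.
Qed.

End contraction.

(** * Faces of the attractor and their recursion *)

Section faces.
Context {R : realType}.
Variables (n : nat) (w : 'cV[R]_2) (eta : R) (A : set 'cV[R]_2).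
Hypotheses (hn : (2 <= n)%N) (hw1 : w 1 0 != 0).
Hypotheses (heta0 : eta != 0) (heta : -1 < eta < 1).
Hypothesis hA : is_attractor n (Psi n eta w) A.
Implicit Types (x y : 'cV[R]_2) (a b : R) (s : bool).

Let F := Psi n eta w.

(* The linear form with value [a] at [w], normalised so that precomposition
   with [Tmx eta] sends [(a, b)] to [(eta * (a + b), eta * b)]. *)
Definition supp a b :=
  lf (b * eta / w 1 0) ((a - b * eta / w 1 0 * w 0 0) / w 1 0).

Definition face a b :=
  [set x | A x /\ forall y, A y -> supp a b y <= supp a b x].

Lemma supp_Psi a b k x :
  supp a b (F k x) = supp (eta * (a + b)) (eta * b) x + digit n k * a.
Proof. by rewrite /supp /lf Psi0E Psi1E; field. Qed.

Lemma suppZ t a b x : supp (t * a) (t * b) x = t * supp a b x.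
Proof. by rewrite /supp /lf; field. Qed.

Lemma lf_supp u v x :
  lf u v x = supp (u * w 0 0 + v * w 1 0) (u * w 1 0 / eta) x.
Proof. by rewrite /supp /lf; field; apply/andP. Qed.

Lemma faceZ t a b : 0 < t -> face (t * a) (t * b) = face a b.
Proof.
move=> t0; apply/seteqP; split=> x [Ax xmax]; split=> // y /xmax;
  by rewrite !suppZ ler_pM2l.
Qed.

Lemma attractorP x : A x <-> exists k y, [/\ (k < n)%N, A y & x = F k y].
Proof.
case: hA => _ _ {1}->; split=> [[k kn [y Ay <-]]|[k [y [kn Ay ->]]]].
  by exists k, y.
by exists k => //; exists y.
Qed.

(** By [supp_Psi] the value at [F k y] is a term in [y] plus a term in [k]. All pairs of a digit and
    a point of [A] occur, so the sum is maximal exactly when both terms are. *)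
Lemma face_recP a b x :
  face a b x <-> exists k y, [/\ (k < n)%N, x = F k y,
    face (eta * (a + b)) (eta * b) y &
    forall l, (l < n)%N -> digit n l * a <= digit n k * a].
Proof.
split=> [[/attractorP[k [y [kn Ay ->]]] xmax]|[k [y [kn -> [Ay ymax] kmax]]]].
  exists k, y; split=> //.
    split=> // z Az; have := xmax (F k z); rewrite !supp_Psi lerD2r; apply.
    by apply/attractorP; exists k, z.
  move=> l ln; have := xmax (F l y); rewrite !supp_Psi lerD2l; apply.
  by apply/attractorP; exists l, y.
split=> [|z /attractorP[l [z' [ln Az' ->]]]].
  by apply/attractorP; exists k, y.
by rewrite !supp_Psi lerD ?ymax ?kmax.
Qed.

(** A boolean names a side of zero, so that one argument covers both signs: [0 < sg s * a] puts [a]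
    strictly on side [s], and [0 <= sg s * a] weakly. *)
Definition sg s : R := if s then 1 else -1.
(** [digit n k] decreases with [k], so index [0] maximises it and index [n.-1] minimises it. *)
Definition extremal_digit s : nat := if s then 0 else n.-1.
(** The side reached after multiplication by [eta]: kept when [eta] is positive, swapped when it is
    negative. *)
Definition next s := s == (0 < eta).

Lemma next_sg s a : sg (next s) * (eta * a) = `|eta| * (sg s * a).
Proof.
rewrite /next /sg; case: ltrP => e0.
  by rewrite gtr0_norm//; case: s => /=; ring.
by rewrite ler0_norm//; case: s => /=; ring.
Qed.

Lemma extremal_digit_lt s : (extremal_digit s < n)%N.
Proof. by case: s => /=; lia. Qed.

Lemma extremal_digitN s : extremal_digit s != extremal_digit (~~ s).
Proof. by case: s => /=; lia. Qed.

Lemma extremal_digit_max s a l : 0 <= sg s * a -> (l < n)%N ->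
  digit n l * a <= digit n (extremal_digit s) * a.
Proof.
move=> sa ln; rewrite -subr_ge0 -mulrBl /digit.
have ln' : 0 <= (n.-1%:R - l%:R : R) by rewrite subr_ge0 ler_nat; lia.
have l0 : 0 <= l%:R :> R by [].
move: sa; rewrite /sg /extremal_digit; case: s => sa; nra.
Qed.

Lemma extremal_digit_uniq s a k : 0 < sg s * a -> (k < n)%N ->
  (forall l, (l < n)%N -> digit n l * a <= digit n k * a) ->
  k = extremal_digit s.
Proof.
move=> sa kn /(_ _ (extremal_digit_lt s)).
rewrite -subr_ge0 -mulrBl /digit => h.
have kn' : (n.-1%:R - k%:R : R) = (n.-1 - k)%:R by rewrite natrB//; lia.
move: sa h; rewrite /sg /extremal_digit; case: s => sa h.
  apply/eqP; rewrite -leqn0 -(ler_nat R); nra.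
suff : (n.-1 - k <= 0)%N by lia.
rewrite -(ler_nat R) -kn'; nra.
Qed.

(** * Continuity of the forms and existence of maximisers *)

Lemma supp_continuous (T : topologicalType) (f g : T -> R) (X : T -> 'cV[R]_2) :
  continuous f -> continuous g -> continuous X ->
  continuous (fun t => supp (f t) (g t) (X t)).
Proof.
move=> cf cg cX.
have cXi i : continuous (fun t => X t i 0).
  move=> t; apply: (@continuous_comp _ _ _ X (fun M : 'cV[R]_2 => M i 0)).
    exact: cX.
  exact: coord_continuous.
(* Regrouping shows that [supp] is linear in its two parameters. *)
have -> : (fun t => supp (f t) (g t) (X t)) =
    (fun t => f t * ((w 1 0)^-1 * X t 1 0) +
      g t * (eta / w 1 0 * X t 0 0 +
        - (eta / w 1 0 * w 0 0 / w 1 0) * X t 1 0)).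
  by apply/funext => t; rewrite /supp /lf; field.
move=> t; apply: cvgD; apply: cvgM; [exact: cf| |exact: cg|apply: cvgD];
  by apply: cvgM; [exact: cvg_cst|exact: cXi].
Qed.

(** The form varies together with the point: constant forms will give compactness of the vertices,
    varying ones that of the arcs. *)
Lemma closed_supporting (T : topologicalType) (f g : T -> R)
  (X : T -> 'cV[R]_2) :
  continuous f -> continuous g -> continuous X ->
  closed [set t | forall y, A y ->
    supp (f t) (g t) y <= supp (f t) (g t) (X t)].
Proof.
move=> cf cg cX.
pose D y t := supp (f t) (g t) (X t) - supp (f t) (g t) y.
rewrite (_ : mkset _ = \bigcap_(y in A) D y @^-1` [set r | 0 <= r]).
  apply: closed_bigI => y Ay; apply: preimage_closed; last exact: closed_ge.
  move=> t _; apply: cvgB; first exact: supp_continuous.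
  by apply: (supp_continuous cf cg) => s; exact: cvg_cst.
by apply/seteqP; split=> t h y /h; rewrite /D /= subr_ge0.
Qed.

Lemma face_nonempty a b : face a b !=set0.
Proof.
case: hA => A0 cA _; have [|x] := @compact_EVT_max _ _ (supp a b) _ A0 cA.
  apply: continuous_subspaceT.
  apply: (@supp_continuous _ (fun=> a) (fun=> b) id).
  - exact: cst_continuous.
  - exact: cst_continuous.
  - by move=> ?; exact: cvg_id.
rewrite inE => Ax xmax; exists x; split=> // y Ay; apply: xmax. by rewrite inE.
Qed.

(** * Vertices *)

Lemma face_step s a b x : 0 < sg s * a -> 0 <= sg s * b -> face a b x ->
  exists2 y, x = F (extremal_digit s) y & face (eta * (a + b)) (eta * b) y.
Proof.
move=> sa sb /face_recP[k [y [kn -> yf kmax]]]; exists y => //.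
by rewrite (extremal_digit_uniq sa kn kmax).
Qed.

(** With [next_sg_ge0], this makes the cone of forms with [a] strictly and [b] weakly on side [s]
    invariant under the dynamics, up to replacing [s] by [next s]. *)
Lemma next_sg_gt0 s a b : 0 < sg s * a -> 0 <= sg s * b ->
  0 < sg (next s) * (eta * (a + b)).
Proof.
by move=> sa sb; rewrite next_sg mulr_gt0 ?normr_gt0// mulrDr ltr_wpDr.
Qed.

Lemma next_sg_ge0 s b : 0 <= sg s * b -> 0 <= sg (next s) * (eta * b).
Proof. by move=> sb; rewrite next_sg mulr_ge0. Qed.

(** Inside the invariant cone the digit chosen at each step depends on the side alone, so the two
    points share an address. The relation quantifies over sides and forms in order to be closed
    under a step. *)
Lemma vertex_uniq s a b a' b' x y :
  0 < sg s * a -> 0 <= sg s * b -> 0 < sg s * a' -> 0 <= sg s * b' ->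
  face a b x -> face a' b' y -> x = y.
Proof.
move=> sa sb sa' sb' xf yf.
have [M AM] : exists M, forall x, A x -> wnorm eta x <= M.
  by case: hA => _ cA _; exact: compact_wnorm_bounded.
apply: (@same_address_eq _ n eta w heta (fun x y => exists s a b a' b',
  [/\ 0 < sg s * a /\ 0 <= sg s * b, 0 < sg s * a' /\ 0 <= sg s * b',
      face a b x & face a' b' y]) (M + M)); last first.
- by exists s, a, b, a', b'.
- move=> {xf yf sa sb sa' sb'}x {}y.
  move=> [{}s [{}a [{}b [{}a' [{}b' [[sa sb] [sa' sb']]]]]]].
  move=> /(face_step sa sb)[x' -> xf] /(face_step sa' sb')[y' -> yf].
  exists (extremal_digit s), x', y'; split=> //.
  exists (next s), (eta * (a + b)), (eta * b), (eta * (a' + b')), (eta * b').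
  by split=> //; split; [exact: next_sg_gt0|exact: next_sg_ge0|
                         exact: next_sg_gt0|exact: next_sg_ge0].
- move=> {xf yf}x {}y [? [? [? [? [? [_ _ [Ax _] [Ay _]]]]]]].
  by rewrite (le_trans (wnormB heta _ _))// lerD ?AM.
Qed.

Definition vertex s := face (sg s) 0.

Lemma sg_sqr s : sg s * sg s = 1.
Proof. by case: s; rewrite /sg; ring. Qed.

(** All forms of the cone expose one and the same point, and [(sg s, 0)] is a chosen representative
    of them. *)
Lemma face_vertex s a b : 0 < sg s * a -> 0 <= sg s * b -> face a b = vertex s.
Proof.
move=> sa sb; have [p pf] := face_nonempty a b.
have [q qf] := face_nonempty (sg s) 0.
have s1 : 0 < sg s * sg s by rewrite sg_sqr.
have s0 : 0 <= sg s * 0 by rewrite mulr0.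
apply/seteqP; split=> x xf.
  by rewrite (vertex_uniq sa sb s1 s0 xf qf).
by rewrite (vertex_uniq s1 s0 sa sb xf pf).
Qed.

Lemma vertexE s : vertex s = F (extremal_digit s) @` vertex (next s).
Proof.
have s1 : 0 < sg s * sg s by rewrite sg_sqr.
have s0 : 0 <= sg s * 0 by rewrite mulr0.
have <- : face (eta * (sg s + 0)) (eta * 0) = vertex (next s).
  by apply: face_vertex; [exact: next_sg_gt0|exact: next_sg_ge0].
apply/seteqP; split=> x; first by move=> /(face_step s1 s0)[y -> yf]; exists y.
move=> [y yf <-]; apply/face_recP; exists (extremal_digit s), y; split=> //.
  exact: extremal_digit_lt.
by move=> l; apply: extremal_digit_max; exact: ltW.
Qed.

(** * Arcs *)

Definition arc s := [set x | exists a b,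
  [/\ (a != 0) || (b != 0), 0 <= sg s * b & face a b x]].

Lemma vertex_arc s t : vertex s `<=` arc t.
Proof.
move=> x xf; exists (sg s), 0; split; rewrite ?mulr0//.
by apply/orP; left; case: s {xf}; rewrite /sg ?oppr_eq0 oner_eq0.
Qed.

(** The position of [a] decides the digit. Strictly opposite to [s], it forces the digit of [~~ s]
    and the next form still belongs to the arc. Strictly on side [s], the face is a vertex. At
    [a = 0] all digits tie, and the next form, being a multiple of [(b, b)], exposes a vertex. *)
Lemma arcE s : arc s =
  \bigcup_(k in [set k | (k < n)%N && (k != extremal_digit (~~ s))])
     F k @` vertex (next s)
  `|` F (extremal_digit (~~ s)) @` arc (next s).
Proof.
have sgN a : sg (~~ s) * a = - (sg s * a) by rewrite /sg; case: s => /=; ring.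
(* The form [(0, sg s)] ranks all digits equally and enters the vertex cone after one step, so every
   [F k] image of the next vertex lies on its face. *)
have fs : face (eta * (0 + sg s)) (eta * sg s) = vertex (next s).
  rewrite add0r; apply: face_vertex; rewrite next_sg sg_sqr mulr1 ?normr_gt0//.
have s1 : (0 != 0 :> R) || (sg s != 0).
  by rewrite eqxx /= /sg; case: s {sgN fs}; rewrite ?oppr_eq0 oner_eq0.
apply/seteqP; split=> x.
  move=> [a [b [ab0 sb /face_recP[k [y [kn -> yf kmax]]]]]].
  case: (ltgtP (sg s * a) 0) => sa.
  - right; rewrite -(@extremal_digit_uniq (~~ s) a k) ?sgN ?oppr_gt0//.
    exists y => //; exists (eta * (a + b)), (eta * b); split=> //.
      rewrite -negb_and !mulf_eq0 (negbTE heta0)/=.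
      apply/negP => /andP[/eqP e1 /eqP e2].
      by move: ab0; rewrite e2 (_ : a = 0) ?eqxx//; lra.
    exact: next_sg_ge0.
  - left; exists k; last first.
      exists y => //.
      by rewrite -(face_vertex (next_sg_gt0 sa sb) (next_sg_ge0 sb)).
    by rewrite /= kn (extremal_digit_uniq sa kn kmax) extremal_digitN.
  - have a0 : a = 0 by rewrite -[a]mul1r -(sg_sqr s) -mulrA sa mulr0.
    have sb' : 0 < sg s * b.
      rewrite lt_neqAle sb andbT eq_sym; move: ab0; rewrite a0 eqxx /=.
      by rewrite mulf_eq0 negb_or => ->; move: s1; rewrite eqxx /= => ->.
    have yv : vertex (next s) y.
      move: yf; rewrite a0 add0r (@face_vertex (next s)) //;
        last exact: next_sg_ge0.
      by rewrite next_sg mulr_gt0 ?normr_gt0.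
    (* The tie includes the digit of [~~ s], which the first union omits; it is recovered in the
       second part because vertices lie in arcs. *)
    have [->|kN] := eqVneq k (extremal_digit (~~ s)).
      by right; exists y => //; exact: vertex_arc yv.
    by left; exists k; [rewrite /= kn|exists y].
have ext0 k y : (k < n)%N -> vertex (next s) y -> arc s (F k y).
  move=> kn yv; exists 0, (sg s); split=> //; first by rewrite sg_sqr.
  by apply/face_recP; exists k, y; split=> //;
    [rewrite fs|move=> l _; rewrite !mulr0].
move=> [[k /andP[kn _] [y yv <-]]|[y [a [b [ab0 sb yf]]] <-]].
  exact: ext0.
(* Run the dynamics backwards: [(a', b')] is the form that one step sends to [(a, b)]. *)
pose b' := b / eta; pose a' := a / eta - b'.
have ea : a = eta * (a' + b') by rewrite /a' subrK mulrC divfK.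
have eb : b = eta * b' by rewrite mulrC divfK.
(* If [a'] is not strictly on side [s], the digit of [~~ s] is optimal for it and the image lies on
   the face of [(a', b')]. Otherwise [y] is already the next vertex and [(0, sg s)] exposes the
   image. *)
case: (lerP (sg s * a') 0) => sa.
  exists a', b'; split.
  - apply: contraTT ab0; rewrite !negb_or !negbK ea eb => /andP[/eqP-> /eqP->].
    by rewrite addr0 mulr0 eqxx.
  - by move: sb; rewrite eb next_sg pmulr_rge0 ?normr_gt0.
  apply/face_recP; exists (extremal_digit (~~ s)), y; rewrite -ea -eb.
  split=> //; first exact: extremal_digit_lt.
  by move=> l; apply: extremal_digit_max; rewrite sgN oppr_ge0.
apply: ext0; first exact: extremal_digit_lt.
have sb' : 0 <= sg s * b' by move: sb; rewrite eb next_sg pmulr_rge0 ?normr_gt0.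
by rewrite -(face_vertex (next_sg_gt0 sa sb') (next_sg_ge0 sb')) -ea -eb.
Qed.

Lemma compact_vertex s : compact (vertex s).
Proof.
case: hA => _ cA _; apply: (compact_closedI cA).
apply: (@closed_supporting _ (fun=> sg s) (fun=> 0) id).
- exact: cst_continuous.
- exact: cst_continuous.
- by move=> ?; exact: cvg_id.
Qed.

(* Rescaling [(a, b)] to [`|a| + `|b| = 1] exhibits the arc as the projection
   of a compact set. *)
Lemma compact_arc s : compact (arc s).
Proof.
have cA : compact A by case: hA.
pose f (p : R * 'cV[R]_2) := sg s * (1 - `|p.1|).
pose K := (`[-1, 1]%classic `*` A) `&`
  [set p : R * 'cV[R]_2 | forall y, A y ->
    supp p.1 (f p) y <= supp p.1 (f p) p.2].
have cfst : continuous (@fst R 'cV[R]_2) by move=> p; exact: cvg_fst.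
have csnd : continuous (@snd R 'cV[R]_2) by move=> p; exact: cvg_snd.
have cK : compact K.
  apply: compact_closedI.
    by apply: compact_setX => //; exact: segment_compact.
  apply: (@closed_supporting _ fst f snd) => //.
  move=> p; apply: cvgM; first exact: cvg_cst.
  apply: cvgB; first exact: cvg_cst.
  exact: cvg_norm (cfst p).
rewrite (_ : arc s = snd @` K).
  by apply: continuous_compact => //; exact: continuous_subspaceT.
apply/seteqP; split=> x.
  move=> [a [b [ab0 sb xf]]].
  pose t := `|a| + `|b|.
  have t0 : 0 < t.
    by rewrite lt_def addr_ge0// andbT paddr_eq0// !normr_eq0 negb_and.
  have bE : sg s * `|b| = b.
    have : sg s * b = `|b|.
      by rewrite -(ger0_norm sb) normrM /sg; case: (s);
         rewrite ?normrN normr1 mul1r.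
    by move=> <-; rewrite mulrA sg_sqr mul1r.
  have sE : sg s * (1 - `|t^-1 * a|) = t^-1 * b.
    rewrite normrM gtr0_norm ?invr_gt0// -[in RHS]bE /t; field.
    exact: lt0r_neq0.
  exists (t^-1 * a, x) => //; split=> /=.
    split=> /=; last by case: xf.
    rewrite in_itv /= -ler_norml normrM gtr0_norm ?invr_gt0//.
    by rewrite mulrC ler_pdivrMr// mul1r lerDl.
  move=> y Ay; rewrite /f /= sE.
  by move: xf; rewrite -(@faceZ t^-1) ?invr_gt0// => -[_ /(_ _ Ay)].
move=> [[a {}x] [[/= + Ax] xmax] <-] /=; rewrite in_itv /= -ler_norml => a1.
exists a, (sg s * (1 - `|a|)); split => //.
- have [->|//] := eqVneq a 0; rewrite normr0 subr0 mulr1 /sg /=.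
  by case: (s); rewrite ?oppr_eq0 oner_eq0.
- by rewrite mulrA sg_sqr mul1r subr_ge0.
Qed.

Lemma arc_nonempty s : arc s !=set0.
Proof.
by have [x xv] := face_nonempty (sg s) 0; exists x; exact: vertex_arc xv.
Qed.

(** * Points on the boundary of the hull as exposed points *)

Lemma ext_pointsP x :
  ext_points A x <-> exists a b, (a != 0) || (b != 0) /\ face a b x.
Proof.
pose C := convex_hull A.
have AC : A `<=` C by exact: sub_gen_smallest.
have cC : convex_set (C : set (convex_lmodType _)).
  move=> y z l; rewrite !inE => Cy Cz K [cK AK].
  have := cK y z l; rewrite !inE; apply; [exact: Cy|exact: Cz].
split=> [[Ax [_ nC]]|[a [b [ab0 [Ax xmax]]]]].
  have [u [v [uv0 xmax]]] := supporting_line cC (AC _ Ax) nC.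
  (* The parameters come from [lf_supp]. They are not both zero: [u != 0] gives [b != 0], and
     [u = 0] leaves [a = v * w 1 0]. *)
  exists (u * w 0 0 + v * w 1 0), (u * w 1 0 / eta); split.
    have [u0|u0] := eqVneq u 0; last first.
      by apply/orP; right; rewrite !mulf_neq0 ?invr_neq0.
    by move: uv0; rewrite u0 eqxx mul0r add0r /= => v0; rewrite mulf_neq0.
  by split=> // y Ay; rewrite -!lf_supp; apply: xmax; exact: AC.
split=> //; split; first by apply: subset_closure; exact: AC.
apply: (@lf_max_not_interior _ (b * eta / w 1 0)
  ((a - b * eta / w 1 0 * w 0 0) / w 1 0)).
  have [b0|b0] := eqVneq b 0; last first.
    by apply/orP; left; rewrite !mulf_neq0 ?invr_neq0.
  move: ab0; rewrite b0 eqxx orbF => a0.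
  by rewrite !mul0r subr0 mulf_neq0 ?orbT ?invr_neq0.
(* A form bounded on [A] has the same bound on the hull, since the half-plane it defines is
   convex. *)
apply: (smallest_sub _ xmax); exact: convex_halfplane.
Qed.

Lemma ext_points_arcs : ext_points A = arc true `|` arc false.
Proof.
apply/seteqP; split=> x.
  move=> /ext_pointsP[a [b [ab0 xf]]].
  have [b0|b0] := leP 0 b; [left|right]; exists a, b; split=> //;
    rewrite /sg; lra.
by move=> [] [a [b [ab0 _ xf]]]; apply/ext_pointsP; exists a, b.
Qed.

End faces.

(** * Assembly for the two signs of [eta] *)

Unset Implicit Arguments.

Theorem theorem5p1 (R : realType) (n : nat) (w : 'cV[R]_2) (eta : R)
    (A : set 'cV[R]_2) (hn : (2 <= n)%N)
    (hw0 : w 0 0 != 0) (hw1 : w 1 0 != 0)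
    (heta0 : eta != 0) (heta : -1 < eta < 1)
    (hA : is_attractor n (Psi n eta w) A) :
  (eta < 0 -> exists B0 B1 B2 B3 : set 'cV[R]_2,
     unique_compact_solution (system_neg n (Psi n eta w)) B0 B1 B2 B3 /\
     ext_points A = B0 `|` B1 `|` B2 `|` B3) /\
  (0 < eta -> exists B0 B1 B2 B3 : set 'cV[R]_2,
     unique_compact_solution (system_pos n (Psi n eta w)) B0 B1 B2 B3 /\
     ext_points A = B0 `|` B1 `|` B2 `|` B3).
Proof.
pose V := vertex w eta A; pose P := arc w eta A.
have V0 s : V s !=set0 by exact: face_nonempty hA _ _.
have P0 s : P s !=set0 by exact: arc_nonempty hA _.
have cV s : compact (V s) by exact: compact_vertex hA _.
have cP s : compact (P s) by exact: compact_arc hA _.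
have VP s t : V s `<=` P t by exact: vertex_arc.
have VE s := vertexE hn hw1 heta0 heta hA s.
have PE s := arcE hn hw1 heta0 heta hA s.
have extE := ext_points_arcs A hw1 heta0.
(* Leaving out the extremal digit of the opposite side removes [n.-1] for [true] and [0] for
   [false], which are the index ranges of the systems. *)
have idx_true : [set k | (k < n)%N && (k != extremal_digit n (~~ true))] =
    [set k | (k <= n - 2)%N].
  by apply/seteqP; split=> k /=; lia.
have idx_false : [set k | (k < n)%N && (k != extremal_digit n (~~ false))] =
    [set k | (1 <= k <= n.-1)%N].
  by apply/seteqP; split=> k /=; lia.
split=> eta_sign.
- have nx s : next eta s = ~~ s by rewrite /next ltNge ltW//; case: s.
  exists (V true), (P true), (V false), (P false); split.
    apply: (compact_solution_unique heta).
      exact: (system_neg_contracting heta).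
    split=> //; split.
    + by rewrite [LHS]VE nx.
    + by rewrite [LHS]PE nx idx_true.
    + by rewrite [LHS]VE nx.
    + by rewrite [LHS]PE nx idx_false setUC.
  (* Each vertex lies in both arcs, so adding the vertices does not enlarge the union. *)
  rewrite extE; apply/seteqP; split=> x.
    by move=> [xP|xP]; [left; left; right|right].
  by move=> [[[/(VP _ true)|]|/(VP _ true)]|]; [left|left|left|right].
- have nx s : next eta s = s by rewrite /next eta_sign; case: s.
  exists (P true), (V false), (V true), (P false); split.
    apply: (compact_solution_unique heta).
      exact: (system_pos_contracting heta).
    split=> //; split.
    + by rewrite [LHS]PE nx idx_true.
    + by rewrite [LHS]VE nx.
    + by rewrite [LHS]VE nx.
    + by rewrite [LHS]PE nx idx_false setUC.
  rewrite extE; apply/seteqP; split=> x.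
    by move=> [xP|xP]; [left; left; left|right].
  by move=> [[[|/(VP _ true)]|/(VP _ true)]|]; [left|left|left|right].
Qed.
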